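(* Fix integers $k$ and $N$ with $0 \leq k < N$. (1) Let $A \in \mathbb{C}^{N \times N}$ be a Hermitian matrix that is $k$-PMP but not $(k+1)$-PMP. Then $A$ has at least $k$ positive eigenvalues and at least one negative eigenvalue (counted with multiplicity). (2) Conversely, for every triple of integers $(n_+, n_0, n_-)$ such that $$n_+ \geq k, \quad n_0 = N - n_+ - n_- \geq 0, \quad \text{and} \quad n_- \geq 1,$$ there exists a Hermitian matrix $A \in \mathbb{C}^{N \times N}$ with signature $(n_+, n_0, n_-)$ such that $A$ is $k$-PMP but not $(k+1)$-PMP.
   Context: For $1 \leq k \leq N$, a Hermitian matrix $A \in \mathbb{C}^{N \times N}$ is called $k$-PMP (principal minor positive) if every principal $j \times j$ minor of $A$ is non-negative for $j = 1, \dots, k$. By convention, every Hermitian matrix is $0$-PMP. The signature of a Hermitian matrix is $(n_+, n_0, n_-)$, where $n_+$, $n_0$ and $n_-$ are the numbers of positive, zero and negative eigenvalues, respectively, counted with multiplicity. *)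

(* Defs.v *)
From mathcomp Require Import all_boot all_order all_algebra.
From mathcomp Require Import complex reals.

Set Implicit Arguments.
Unset Strict Implicit.
Unset Printing Implicit Defensive.

Import Order.TTheory GRing.Theory Num.Theory.
Local Open Scope ring_scope.

(* In a numClosedFieldType, 0 <= z (resp. 0 < z, z < 0) means that z is real
   and nonnegative (resp. positive, negative).  Principal minors and
   eigenvalues of a Hermitian matrix are real, so for such matrices the
   comparisons below are the usual ones. *)

Section PMP.
Variables (C : numClosedFieldType) (N : nat).
Implicit Types (A : 'M[C]_N) (S : {set 'I_N}) (k : nat).

(* enum_val lists the elements of S in increasing order. *)
Definition principal_minor A S : C :=
  \det (mxsub (@enum_val _ (mem S)) (@enum_val _ (mem S)) A).

(* Meant for Hermitian A, which is assumed separately. *)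
Definition PMP k A : Prop :=
  forall S, (1 <= #|S| <= k)%N -> 0 <= principal_minor A S.

(* Roots of the characteristic polynomial, with multiplicity. *)
Definition eigenvalues A : seq C :=
  sval (closed_field_poly_normal (char_poly A)).

Lemma char_poly_eigenvalues A :
  char_poly A = \prod_(x <- eigenvalues A) ('X - x%:P).
Proof.
rewrite /eigenvalues; case: closed_field_poly_normal => s /= {1}->.
by rewrite (monicP (char_poly_monic A)) scale1r.
Qed.

Definition pos_index A : nat := count (fun x => 0 < x) (eigenvalues A).
Definition zero_index A : nat := count (fun x => x == 0) (eigenvalues A).
Definition neg_index A : nat := count (fun x => x < 0) (eigenvalues A).

Definition signature A : nat * nat * nat := (pos_index A, zero_index A, neg_index A).

End PMP.

(* Main.v *)
Require Import Defs.
From mathcomp Require Import all_boot all_order all_algebra.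
From mathcomp Require Import complex reals perm zify.

(** Let [A] be k-PMP but not (k+1)-PMP. Some principal submatrix [B] of size
[k + 1] has negative determinant, while all its proper principal minors are
nonnegative. The coefficients of [det (X + B)] are sums of principal minors of
[B] ([det_add_diag]), so only the constant one is negative, and by Descartes'
rule of signs this polynomial has at most one positive root, counted with
multiplicity ([count_pos_roots_le1]). Its roots are the opposites of the
eigenvalues of [B]; since [det B < 0], exactly one eigenvalue of [B] is negative
and the [k] others are positive. Positive and negative indices do not increase
when passing to a principal submatrix ([pos_index_mxsub], by the description
of the positive index as the largest dimension of a positive definite
subspace), so [A] has at least [k] positive and one negative eigenvalue.

Conversely, let [n = k + n_-] and let [W] be an [n x k] Vandermonde matrix, any
[k] rows of which are independent. The Gram matrix of its rows has rank [k], and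
its principal submatrices of size at most [k] are positive definite. For a small
[eps > 0] the latter remain so when [eps] is subtracted from the diagonal,
while the [n - k] zero eigenvalues become negative. The result has signature
[(k, 0, n_-)] and is k-PMP; a principal submatrix of size [k + 1] has signature
[(k, 0, 1)] for the same reason, hence a negative determinant
([exists_minimal_pos_index]). A direct sum with an identity block and a zero
block provides the missing eigenvalues. *)

Set Implicit Arguments.
Unset Strict Implicit.
Unset Printing Implicit Defensive.

Import Order.TTheory GRing.Theory Num.Theory.
Local Open Scope ring_scope.
Local Open Scope sesquilinear_scope.

(** * Determinants and principal minors *)

Section Minors.
Variable R : comNzRingType.

(** The full-size matrix which is [A] on the rows of [S] and the identity on
the other rows.  Its determinant is the minor of [A] on [S]
([det_patch_minor]), and it makes Leibniz expansions over varying [S]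
possible without changing the type of the matrices. *)
Definition patch n (S : {set 'I_n}) (A : 'M[R]_n) : 'M[R]_n :=
  \matrix_(i, j) (if i \in S then A i j else (i == j)%:R).

Lemma det_mxsub_bij m n (h : 'I_m -> 'I_n) (A : 'M[R]_n) :
  bijective h -> \det (mxsub h h A) = \det A.
Proof.
move=> h_bij; have Emn : m = n by have := bij_eq_card h_bij; rewrite !card_ord.
subst n.
pose s := perm (bij_inj h_bij).
have -> : mxsub h h A = row_perm s (col_perm s A).
  by apply/matrixP=> i j; rewrite !mxE !permE.
rewrite row_permE col_permE !det_mulmx !det_perm odd_permV mulrCA.
by rewrite -signr_addb addbb mulr1.
Qed.

(** Listing the rows of [S] before the others turns [patch S A] into a block
triangular matrix with an identity block. *)
Lemma det_patch_minor n (S : {set 'I_n}) (A : 'M[R]_n) :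
  \det (mxsub (@enum_val _ (mem S)) (@enum_val _ (mem S)) A)
  = \det (patch S A).
Proof.
pose h (i : 'I_(#|S| + #|~: S|)) : 'I_n :=
  match split i with
  | inl a => @enum_val _ (mem S) a
  | inr b => @enum_val _ (mem (~: S)) b
  end.
have hl a : h (lshift _ a) = @enum_val _ (mem S) a.
  by rewrite /h (unsplitK (inl a)).
have hr b : h (rshift _ b) = @enum_val _ (mem (~: S)) b.
  by rewrite /h (unsplitK (inr b)).
have inS a : @enum_val _ (mem S) a \in S by exact: enum_valP.
have notinS b : @enum_val _ (mem (~: S)) b \notin S.
  by have := enum_valP b; rewrite inE.
have h_inj : injective h.
  move=> i j; case: (split_ordP i) => a ->; case: (split_ordP j) => b ->;
    rewrite ?hl ?hr.
  - by move/enum_val_inj->.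
  - by move=> e; have := notinS b; rewrite -e inS.
  - by move=> e; have := notinS a; rewrite e inS.
  - by move/enum_val_inj->.
have h_bij : bijective h.
  by apply: inj_card_bij => //; rewrite !card_ord cardsC card_ord.
rewrite -(det_mxsub_bij (patch S A) h_bij).
have -> : mxsub h h (patch S A) =
    block_mx (mxsub (@enum_val _ (mem S)) (@enum_val _ (mem S)) A)
      (mxsub (@enum_val _ (mem S)) (@enum_val _ (mem (~: S))) A) 0 1%:M.
  apply/matrixP=> i j; case: (split_ordP i) => a ->; case: (split_ordP j) => b ->;
    rewrite ?block_mxEul ?block_mxEur ?block_mxEdl ?block_mxEdr !mxE ?hl ?hr;
    rewrite ?inS ?(negbTE (notinS _)) //.
  - by case: eqP => // e; have := notinS a; rewrite e inS.
  - by rewrite (inj_eq enum_val_inj).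
by rewrite det_ublock det1 mulr1.
Qed.

(** Multiplying out each row of [A + diag d] as a row of [A] plus a multiple of
a row of the identity. *)
Lemma det_add_diag n (A : 'M[R]_n) (d : 'rV[R]_n) :
  \det (A + diag_mx d) =
  \sum_(J : {set 'I_n}) (\prod_(i in ~: J) d 0 i) * \det (patch J A).
Proof.
rewrite /determinant.
under eq_bigr => s _.
  rewrite (eq_bigr (fun i => A i (s i) + d 0 i * (i == s i)%:R)); last first.
    by move=> i _; rewrite !mxE mulr_natr.
  rewrite bigA_distr mulr_sumr.
over.
rewrite exchange_big /=; apply: eq_big => [J|J _]; first by rewrite inE.
rewrite mulr_sumr; apply: eq_bigr => s _.
rewrite mulrCA; congr (_ * _).
rewrite [X in X * _](big_mkcond (fun i => i \in ~: J)) -big_split /=.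
apply: eq_bigr => i _; rewrite mxE inE; case: (i \in J) => //=.
by rewrite mul1r.
Qed.

Lemma patch_block m n (A : 'M[R]_m) (B : 'M[R]_n) (S : {set 'I_(m + n)}) :
  patch S (block_mx A 0 0 B) =
  block_mx (patch [set i | lshift n i \in S] A) 0
           0 (patch [set i | rshift m i \in S] B).
Proof.
apply/matrixP=> i j; case: (split_ordP i) => a ->; case: (split_ordP j) => b ->;
  rewrite mxE ?block_mxEul ?block_mxEur ?block_mxEdl ?block_mxEdr !mxE ?inE;
  by rewrite ?eq_lshift ?eq_rshift ?eq_lrshift ?eq_rlshift ?if_same.
Qed.

End Minors.

Section PrincipalMinors.
Variable C : numClosedFieldType.

Definition principal_submx n (A : 'M[C]_n) (S : {set 'I_n}) : 'M[C]_#|S| :=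
  mxsub (@enum_val _ (mem S)) (@enum_val _ (mem S)) A.

Lemma principal_minorE n (A : 'M[C]_n) (S : {set 'I_n}) :
  principal_minor A S = \det (patch S A).
Proof. exact: det_patch_minor. Qed.

Lemma principal_minor0 n (A : 'M[C]_n) : principal_minor A set0 = 1.
Proof.
rewrite principal_minorE -[RHS](det1 C n); congr (\det _).
by apply/matrixP=> i j; rewrite !mxE inE.
Qed.

Lemma principal_minor_block m n (A : 'M[C]_m) (B : 'M[C]_n) S :
  principal_minor (block_mx A 0 0 B) S =
  principal_minor A [set i | lshift n i \in S] *
  principal_minor B [set i | rshift m i \in S].
Proof. by rewrite !principal_minorE patch_block det_ublock. Qed.

Lemma enum_rank_codom m n (f : 'I_m -> 'I_n) (S : {set 'I_n}) :
    (forall i, f i \in S) ->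
  {g : 'I_m -> 'I_#|S| | forall i, @enum_val _ (mem S) (g i) = f i}.
Proof.
by move=> fS; exists (fun i => enum_rank_in (fS i) (f i)) => i; rewrite enum_rankK_in.
Qed.

(** A determinant does not depend on the order in which the chosen indices are
listed, provided rows and columns are listed in the same order. *)
Lemma det_mxsub_inj m n (f : 'I_m -> 'I_n) (A : 'M[C]_n) :
  injective f -> \det (mxsub f f A) = principal_minor A (f @: setT).
Proof.
move=> f_inj; have [|g gE] := @enum_rank_codom _ _ f (f @: setT).
  by move=> i; apply: imset_f; rewrite inE.
have -> : mxsub f f A = mxsub g g (principal_submx A (f @: setT)).
  by apply/matrixP=> i j; rewrite !mxE !gE.
rewrite det_mxsub_bij //; apply: inj_card_bij => [i j eq_g|].
  by apply: f_inj; rewrite -!gE eq_g.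
by rewrite !card_ord card_imset // cardsT card_ord.
Qed.

Lemma principal_minor_mxsub m n (f : 'I_m -> 'I_n) (A : 'M[C]_n) S :
  injective f -> principal_minor (mxsub f f A) S = principal_minor A (f @: S).
Proof.
move=> f_inj.
have -> : principal_minor (mxsub f f A) S =
    \det (mxsub (f \o @enum_val _ (mem S)) (f \o @enum_val _ (mem S)) A).
  by congr (\det _); apply/matrixP=> i j; rewrite !mxE.
rewrite det_mxsub_inj; last exact: inj_comp f_inj enum_val_inj.
rewrite imset_comp; suff -> : @enum_val _ (mem S) @: setT = S by [].
apply/setP=> x; apply/imsetP/idP => [[i _ ->]|xS]; first exact: enum_valP.
by exists (enum_rank_in xS x); rewrite ?inE // enum_rankK_in.
Qed.

Lemma PMP_mxsub k m n (f : 'I_m -> 'I_n) (A : 'M[C]_n) :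
  injective f -> PMP k A -> PMP k (mxsub f f A).
Proof. by move=> f_inj PA S cS; rewrite principal_minor_mxsub // PA ?card_imset. Qed.

Lemma PMP_minor_ge0 k n (A : 'M[C]_n) (S : {set 'I_n}) :
  PMP k A -> (#|S| <= k)%N -> 0 <= principal_minor A S.
Proof.
move=> PA cS; have [->|S_neq0] := eqVneq S set0.
  by rewrite principal_minor0 ler01.
by rewrite PA // cS card_gt0 S_neq0.
Qed.

Lemma PMP_block k m n (A : 'M[C]_m) (B : 'M[C]_n) :
  PMP k A -> PMP k B -> PMP k (block_mx A 0 0 B).
Proof.
move=> PA PB S /andP[_ cS]; rewrite principal_minor_block.
apply: mulr_ge0; apply: (PMP_minor_ge0 (k := k)) => //; apply: leq_trans cS.
  by rewrite -(card_imset _ (@lshift_inj m n)) subset_leq_card //;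
     apply/subsetP=> _ /imsetP[i + ->]; rewrite inE.
by rewrite -(card_imset _ (@rshift_inj m n)) subset_leq_card //;
   apply/subsetP=> _ /imsetP[i + ->]; rewrite inE.
Qed.

Lemma PMP_scalar k n (a : C) : 0 <= a -> PMP k (a%:M : 'M[C]_n).
Proof.
move=> a_ge0 S _; rewrite /principal_minor.
have -> : mxsub (@enum_val _ (mem S)) (@enum_val _ (mem S)) (a%:M : 'M_n) = a%:M.
  by apply/matrixP=> i j; rewrite !mxE (inj_eq enum_val_inj).
by rewrite det_scalar exprn_ge0.
Qed.

End PrincipalMinors.

(** * A rule of signs *)

Section RuleOfSigns.
Variable C : numClosedFieldType.
Implicit Types (p r : {poly C}) (s : seq C).

(** Synthetic division by ['X - a] computes the coefficients of the quotient
from the top down by [r_j = p_(j+1) + a r_(j+1)], which preserves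
nonnegativity and never reads the constant coefficient of [p]. *)
Lemma quotient_coef_ge0 r (a : C) : 0 <= a ->
  (forall j, 0 <= (('X - a%:P) * r)`_j.+1) -> forall j, 0 <= r`_j.
Proof.
move=> a_ge0 p_ge0 j.
have [m le_rm] : exists m, (size r <= j + m)%N by exists (size r); rewrite leq_addl.
elim: m j le_rm => [|m IHm] j le_rm; first by rewrite nth_default // -[j]addn0.
have := p_ge0 j; rewrite mulrBl coefB coefXM mul_polyC coefZ /= subr_ge0.
by apply: le_trans; rewrite mulr_ge0 // IHm // addSnnS.
Qed.

Lemma coef_ge0_root_gt0 r (b : C) :
  (forall j, 0 <= r`_j) -> 0 < b -> root r b -> r = 0.
Proof.
move=> r_ge0 b_gt0 /eqP; rewrite horner_coef => sum0.
have term0 := psumr_eq0P (fun (i : 'I_(size r)) _ =>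
  mulr_ge0 (r_ge0 i) (ltW (exprn_gt0 i b_gt0))) sum0.
apply/polyP=> j; rewrite coef0; case: (ltnP j (size r)) => [lt_jr|]; last first.
  exact: nth_default.
have /eqP := term0 (Ordinal lt_jr) isT.
by rewrite mulf_eq0 (gt_eqF (exprn_gt0 _ b_gt0)) orbF => /eqP.
Qed.

(** The case of Descartes' rule with at most one sign change: after division by
['X - a] for a positive root [a], all coefficients are nonnegative, so
that no positive root is left. *)
Lemma count_pos_roots_le1 s :
  (forall j, 0 <= (\prod_(x <- s) ('X - x%:P))`_j.+1) ->
  (count (fun x => 0 < x)%R s <= 1)%N.
Proof.
move=> p_ge0; rewrite leqNgt; apply/negP => cnt.
have /hasP[a a_s a_gt0] : has (fun x => 0 < x) s by rewrite has_count (ltnW cnt).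
have s_a := perm_to_rem a_s; move: cnt.
rewrite (seq.permP s_a) /= a_gt0 ltnS -has_count => /hasP[b b_s b_gt0].
have p_ge0' j : 0 <= (('X - a%:P) * \prod_(x <- rem a s) ('X - x%:P))`_j.+1.
  by have := p_ge0 j; rewrite (perm_big _ s_a) big_cons.
have := coef_ge0_root_gt0 (quotient_coef_ge0 (ltW a_gt0) p_ge0') b_gt0.
rewrite root_prod_XsubC => /(_ b_s)/eqP.
by rewrite (negbTE (monic_neq0 (monic_prod_XsubC _ _ _))).
Qed.

(** The coefficient of ['X^j] in [det ('X + A)] is the sum of the
principal minors of size [n - j], so only the full determinant is left out of
the hypothesis, and it is the constant coefficient. *)
Lemma pos_index_opp_le1 n (A : 'M[C]_n) :
  (forall S, S != setT -> 0 <= principal_minor A S) -> (pos_index (- A) <= 1)%N.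
Proof.
move=> minors_ge0; apply: count_pos_roots_le1 => j; rewrite -char_poly_eigenvalues.
have -> : char_poly (- A) = \det (map_mx polyC A + diag_mx (const_mx 'X)).
  congr (\det _); apply/matrixP=> u v; rewrite !mxE polyCN opprK addrC.
  by [].
rewrite det_add_diag coef_sum sumr_ge0 // => J _.
have -> : patch J (map_mx polyC A) = map_mx polyC (patch J A).
  by apply/matrixP=> u v; rewrite !mxE; case: ifP => // _; rewrite polyC_natr.
rewrite det_map_mx -principal_minorE coefMC.
rewrite (eq_bigr (fun=> 'X)); last by move=> i _; rewrite mxE.
rewrite prodr_const coefXn; have [->|J_neqT] := eqVneq J setT.
  by rewrite setCT cards0 mul0r.
by rewrite mulr_ge0 ?ler0n ?minors_ge0.
Qed.

End RuleOfSigns.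

(** * Eigenvalues and inertia *)

Section Inertia.
Variable C : numClosedFieldType.

Lemma hermsymmxP n (A : 'M[C]_n) : reflect (A^t* = A) (A \is hermsymmx).
Proof.
by apply: (iffP (is_hermitianmxP _ _ _)); rewrite expr0 scale1r => /esym.
Qed.

Lemma size_eigenvalues n (A : 'M[C]_n) : size (eigenvalues A) = n.
Proof.
apply: succn_inj; rewrite -(size_char_poly A) char_poly_eigenvalues.
by rewrite size_prod_XsubC.
Qed.

Lemma det_eigenvalues n (A : 'M[C]_n) : \det A = \prod_(x <- eigenvalues A) x.
Proof.
have := char_poly_det A; rewrite char_poly_eigenvalues -horner_coef0 horner_prod.
under eq_bigr do rewrite hornerXsubC sub0r -mulN1r.
rewrite big_split /= big_const_seq count_predT size_eigenvalues iter_mulr_1.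
by move/(mulfI (negbT (signr_eq0 _ _)))/esym.
Qed.

Lemma eigenvalues_perm n (A : 'M[C]_n) s :
  char_poly A = \prod_(x <- s) ('X - x%:P) -> perm_eq (eigenvalues A) s.
Proof. by rewrite char_poly_eigenvalues; apply: prod_XsubC_eq. Qed.

Lemma char_poly_similar n (P A : 'M[C]_n) :
  P \in unitmx -> char_poly (invmx P *m A *m P) = char_poly A.
Proof.
move=> P_unit; rewrite /char_poly.
pose Q := map_mx polyC P; pose Q' := map_mx polyC (invmx P).
have Q'Q : Q' *m Q = 1%:M by rewrite -map_mxM mulVmx // map_mx1.
have -> : char_poly_mx (invmx P *m A *m P) = Q' *m char_poly_mx A *m Q.
  rewrite /char_poly_mx mulmxBr mulmxBl scalar_mxC -(mulmxA _ Q' Q) Q'Q mulmx1.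
  by rewrite !map_mxM.
by rewrite !det_mulmx mulrAC -det_mulmx Q'Q det1 mul1r.
Qed.

Lemma eigenvalues_similar_diag n (P : 'M[C]_n) (d : 'rV_n) :
  P \in unitmx ->
  perm_eq (eigenvalues (invmx P *m diag_mx d *m P)) [seq d 0 i | i : 'I_n].
Proof.
move=> P_unit; apply: eigenvalues_perm; rewrite char_poly_similar //.
rewrite char_poly_trig ?diag_mx_is_trig // big_image /=.
by apply: eq_bigr => i _; rewrite mxE eqxx.
Qed.

Lemma eigenvalues_scalar n (a : C) :
  perm_eq (eigenvalues (a%:M : 'M_n)) (nseq n a).
Proof.
apply: eigenvalues_perm; rewrite char_poly_trig ?scalar_mx_is_trig //.
rewrite big_nseq -big_const_ord.
by apply: eq_bigr => i _; rewrite mxE eqxx.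
Qed.

Lemma eigenvalues_block m n (A : 'M[C]_m) (B : 'M[C]_n) :
  perm_eq (eigenvalues (block_mx A 0 0 B)) (eigenvalues A ++ eigenvalues B).
Proof.
apply: eigenvalues_perm; rewrite big_cat -!char_poly_eigenvalues.
by rewrite /char_poly char_block_diag_mx det_ublock.
Qed.

Lemma signature_block m n (A : 'M[C]_m) (B : 'M[C]_n) pA zA mA pB zB mB :
  signature A = (pA, zA, mA) -> signature B = (pB, zB, mB) ->
  signature (block_mx A 0 0 B) = (pA + pB, zA + zB, mA + mB)%N.
Proof.
rewrite /signature /pos_index /zero_index /neg_index => -[<- <- <-] [<- <- <-].
by rewrite !(seq.permP (eigenvalues_block A B)) !count_cat.
Qed.

Lemma signature_scalar n (a : C) :
  signature (a%:M : 'M_n) = ((0 < a)%R * n, (a == 0%R) * n, (a < 0)%R * n)%N.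
Proof.
rewrite /signature /pos_index /zero_index /neg_index.
by rewrite !(seq.permP (eigenvalues_scalar n a)) !count_nseq.
Qed.

Lemma hermitian_diagonalization n (A : 'M[C]_n) : A \is hermsymmx ->
  exists P : 'M_n, exists d : 'rV_n, [/\ P \is unitarymx, d \is a realmx &
    A = invmx P *m diag_mx d *m P].
Proof.
move=> Ah; exists (spectralmx A), (spectral_diag A); split.
- exact: spectral_unitarymx.
- exact: hermitian_spectral_diag_real.
- exact/orthomx_spectralP/hermitian_normalmx.
Qed.

Lemma eigenvalues_real n (A : 'M[C]_n) :
  A \is hermsymmx -> {in eigenvalues A, forall x, x \is Num.real}.
Proof.
move=> /hermitian_diagonalization[P [d [/unitarymx_unit P_unit /mxOverP d_real ->]]] x.
by rewrite (perm_mem (eigenvalues_similar_diag d P_unit)) => /imageP[i _ ->].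
Qed.

Lemma eigenvalues_affine n (A : 'M[C]_n) (a b : C) : A \is hermsymmx ->
  perm_eq (eigenvalues (a *: A + b%:M)) [seq a * x + b | x <- eigenvalues A].
Proof.
move=> /hermitian_diagonalization[P [d [/unitarymx_unit P_unit _ ->]]].
have /perm_map/permPr-> := eigenvalues_similar_diag d P_unit.
pose e := a *: d + const_mx b.
have -> : a *: (invmx P *m diag_mx d *m P) + b%:M = invmx P *m diag_mx e *m P.
  have -> : diag_mx e = a *: diag_mx d + b%:M.
    by apply/matrixP=> i j; rewrite !mxE mulrnDl mulrnAr.
  rewrite mulmxDr mulmxDl -scalemxAr -scalemxAl; congr (_ + _).
  by rewrite scalar_mxC mulmxKV.
apply: perm_trans (eigenvalues_similar_diag e P_unit) _.
rewrite -map_comp (eq_map (g := fun i => e 0 i)) // => i.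
by rewrite /= !mxE.
Qed.

Lemma neg_index_opp n (A : 'M[C]_n) :
  A \is hermsymmx -> neg_index A = pos_index (- A).
Proof.
move=> /(eigenvalues_affine (-1) 0); rewrite scaleN1r raddf0 addr0 => eqA.
rewrite /pos_index (seq.permP eqA) count_map; apply: eq_count => x /=.
by rewrite mulN1r addr0 oppr_gt0.
Qed.

Lemma index_sum n (A : 'M[C]_n) : A \is hermsymmx ->
  (pos_index A + zero_index A + neg_index A = n)%N.
Proof.
move=> Ah; rewrite -[RHS](size_eigenvalues A) /pos_index /zero_index /neg_index.
have := eigenvalues_real Ah; elim: (eigenvalues A) => //= x s IHs xs_real.
rewrite -IHs => [|y ys]; last by rewrite xs_real // inE ys orbT.
have : x \is Num.real by rewrite xs_real ?inE ?eqxx.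
by case/real_ltgt0P => _ /=; rewrite ?add0n ?add1n ?addnS ?addSn.
Qed.

End Inertia.

(** * Inertia and subspaces *)

Section Forms.
Variable C : numClosedFieldType.

Definition qform n (A : 'M[C]_n) (u : 'rV[C]_n) : C := (u *m A *m u^t*) 0 0.

Lemma qformD n (A B : 'M[C]_n) u : qform (A + B) u = qform A u + qform B u.
Proof. by rewrite /qform mulmxDr mulmxDl mxE. Qed.

Lemma qform0 n (A : 'M[C]_n) : qform A 0 = 0.
Proof. by rewrite /qform !mul0mx mxE. Qed.

Lemma qformN n (A : 'M[C]_n) u : qform (- A) u = - qform A u.
Proof. by rewrite /qform mulmxN mulNmx mxE. Qed.

Lemma qform_scalar n (a : C) (u : 'rV_n) : qform a%:M u = a * qform 1%:M u.
Proof. by rewrite /qform mul_mx_scalar mulmx1 -scalemxAl mxE. Qed.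

Lemma qform1_gt0 n (u : 'rV[C]_n) : u != 0 -> 0 < qform 1%:M u.
Proof. by rewrite /qform mulmx1 -dotmxE; apply: dotmx_is_dotmx. Qed.

Lemma qform_congr m n (V : 'M[C]_(m, n)) (A : 'M[C]_n) u :
  qform (V *m A *m V^t*) u = qform A (u *m V).
Proof. by rewrite /qform trmx_mul map_mxM !mulmxA. Qed.

Lemma qform_diag n (d : 'rV[C]_n) u :
  qform (diag_mx d) u = \sum_i d 0 i * `|u 0 i| ^+ 2.
Proof.
rewrite /qform mul_mx_diag !mxE; apply: eq_bigr => i _.
by rewrite !mxE normCK mulrAC mulrC mulrA.
Qed.

Lemma qform_unitary_diag n (P : 'M[C]_n) (d : 'rV_n) u : P \is unitarymx ->
  qform (invmx P *m diag_mx d *m P) u = qform (diag_mx d) (u *m P^t*).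
Proof. by move=> Pu; rewrite -qform_congr trmxCK invmx_unitary. Qed.

Lemma pos_index_similar_diag n (P : 'M[C]_n) (d : 'rV_n) : P \in unitmx ->
  pos_index (invmx P *m diag_mx d *m P) = #|[set i | 0 < d 0 i]|.
Proof.
move=> P_unit; rewrite /pos_index (seq.permP (eigenvalues_similar_diag d P_unit)).
by rewrite -sum1_count big_image_cond -sum1dep_card.
Qed.

(** A positive definite subspace is spanned by the rows of the diagonalizing
unitary matrix that belong to positive eigenvalues. *)
Lemma pos_subspace n (A : 'M[C]_n) : A \is hermsymmx ->
  exists V : 'M[C]_(pos_index A, n),
    forall u, u != 0 -> 0 < qform A (u *m V).
Proof.
case/hermitian_diagonalization=> P [d [Pu d_real ->]].
rewrite pos_index_similar_diag ?unitarymx_unit //.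
pose f := @enum_val _ (mem [set i | 0 < d 0 i]).
exists (rowsub f P) => u u_neq0.
rewrite qform_unitary_diag // -mulmxA mul_rowsub_mx (unitarymxP Pu) qform_diag.
set w := u *m _.
have w_pos i : w 0 i != 0 -> 0 < d 0 i.
  apply: contraNT => d_le0; rewrite mxE big1 // => j _; rewrite !mxE.
  case: eqP => [fj_i|]; last by rewrite mulr0.
  by have := enum_valP j; rewrite inE -/(f j) fj_i (negbTE d_le0).
have term_ge0 i : 0 <= d 0 i * `|w 0 i| ^+ 2.
  have [->|/w_pos d_gt0] := eqVneq (w 0 i) 0; first by rewrite normr0 expr0n mulr0.
  by rewrite mulr_ge0 ?exprn_ge0 // ltW.
rewrite lt_def sumr_ge0 // andbT; apply: contra_neq u_neq0 => /psumr_eq0P sum0.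
have w0 : w = 0.
  apply/rowP=> i; rewrite [RHS]mxE; apply/eqP/negPn/negP => wi_neq0.
  have /eqP := sum0 (fun i _ => term_ge0 i) i isT.
  by rewrite mulf_eq0 (gt_eqF (w_pos _ wi_neq0)) expf_eq0 normr_eq0 (negbTE wi_neq0).
have -> : u = colsub f w.
  rewrite -mulmx_colsub; have -> : colsub f (rowsub f 1%:M) = 1%:M :> 'M[C]__.
    by apply/matrixP=> i j; rewrite !mxE (inj_eq enum_val_inj).
  by rewrite mulmx1.
by rewrite w0 mxsub_const.
Qed.

(** A subspace of larger dimension than the number of positive eigenvalues
contains a nonzero vector orthogonal to all their eigenvectors, and the form is
not positive there. *)
Lemma pos_index_ge d n (A : 'M[C]_n) (V : 'M[C]_(d, n)) : A \is hermsymmx ->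
  (forall u, u != 0 -> 0 < qform A (u *m V)) -> (d <= pos_index A)%N.
Proof.
case/hermitian_diagonalization=> P [e [Pu /mxOverP e_real ->]].
rewrite pos_index_similar_diag ?unitarymx_unit // => V_pos.
rewrite leqNgt; apply/negP => lt_d.
pose f := @enum_val _ (mem [set i | 0 < e 0 i]).
pose M := colsub f (V *m P^t*).
have /rowV0Pn[u uM u_neq0] : kermx M != 0.
  by rewrite -mxrank_eq0 mxrank_ker subn_eq0 -ltnNge (leq_ltn_trans (rank_leq_col _)).
have := V_pos u u_neq0; rewrite qform_unitary_diag // qform_diag.
apply/negP; rewrite le_gtF // sumr_le0 // => i _.
case: (real_ltgt0P (e_real 0 i)) => [e_gt0|e_lt0|->]; last by rewrite mul0r.
  have /= Ti : i \in [set i | 0 < e 0 i] by rewrite inE.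
  suff -> : (u *m V *m P^t*) 0 i = 0 by rewrite normr0 expr0n mulr0.
  have /rowP/(_ (enum_rank_in Ti i)) := sub_kermxP uM.
  by rewrite /M mulmx_colsub mulmxA mxE /f enum_rankK_in // [RHS]mxE.
by rewrite mulr_le0_ge0 ?exprn_ge0 // ltW.
Qed.

Lemma hermsymmx_mxsub m n (f : 'I_m -> 'I_n) (A : 'M[C]_n) :
  A \is hermsymmx -> mxsub f f A \is hermsymmx.
Proof.
move=> /hermsymmxP Ah; apply/hermsymmxP/matrixP=> i j.
by have /matrixP/(_ (f i) (f j)) := Ah; rewrite !mxE.
Qed.

Lemma hermsymmx_affine n (A : 'M[C]_n) (a b : C) :
    a \is Num.real -> b \is Num.real ->
  A \is hermsymmx -> a *: A + b%:M \is hermsymmx.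
Proof.
move=> /CrealP a_real /CrealP b_real /hermsymmxP/matrixP Ah.
apply/hermsymmxP/matrixP=> i j; have := Ah i j; rewrite !mxE => <-.
by rewrite rmorphD rmorphM rmorphMn /= a_real b_real [j == i]eq_sym.
Qed.

Lemma hermsymmxN n (A : 'M[C]_n) : A \is hermsymmx -> - A \is hermsymmx.
Proof.
move=> Ah; have := @hermsymmx_affine _ A (-1) 0.
by rewrite scaleN1r raddf0 addr0 rpredN; apply; rewrite ?real1 ?real0.
Qed.

Lemma hermsymmx_block m n (A : 'M[C]_m) (B : 'M[C]_n) :
  A \is hermsymmx -> B \is hermsymmx -> block_mx A 0 0 B \is hermsymmx.
Proof.
move=> /hermsymmxP Ah /hermsymmxP Bh; apply/hermsymmxP.
by rewrite tr_block_mx map_block_mx !trmx0 !map_mx0 Ah Bh.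
Qed.

Lemma hermsymmx_scalar n (a : C) : a \is Num.real -> (a%:M : 'M_n) \is hermsymmx.
Proof.
by move=> /CrealP a_real; apply/hermsymmxP; rewrite tr_scalar_mx map_scalar_mx /= a_real.
Qed.

(** The consequence of Cauchy interlacing that matters here: a compression of
the form to coordinate vectors has no larger positive index. *)
Lemma pos_index_mxsub m n (f : 'I_m -> 'I_n) (A : 'M[C]_n) :
  A \is hermsymmx -> (pos_index (mxsub f f A) <= pos_index A)%N.
Proof.
move=> Ah; have [V V_pos] := pos_subspace (hermsymmx_mxsub f Ah).
pose E : 'M[C]_(m, n) := rowsub f 1%:M.
have fAf : mxsub f f A = E *m A *m E^t*.
  rewrite mul_rowsub_mx mul1mx.
  have -> : E^t* = colsub f 1%:M.
    by apply/matrixP=> i j; rewrite !mxE rmorph_nat eq_sym.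
  by rewrite mulmx_colsub mulmx1 -mxsubcr.
apply: (@pos_index_ge _ _ _ (V *m E)) => // u u_neq0.
by rewrite mulmxA -qform_congr -fAf; apply: V_pos.
Qed.

Lemma neg_index_mxsub m n (f : 'I_m -> 'I_n) (A : 'M[C]_n) :
  A \is hermsymmx -> (neg_index (mxsub f f A) <= neg_index A)%N.
Proof.
move=> Ah; rewrite !neg_index_opp ?hermsymmx_mxsub //.
by have -> : - mxsub f f A = mxsub f f (- A);
  [apply/matrixP=> i j; rewrite !mxE | exact/pos_index_mxsub/hermsymmxN].
Qed.

(** * Inertia of matrices that are k-PMP but not (k+1)-PMP *)

(** A failing minor has size [k + 1], and the submatrix [B] on it has
nonnegative proper principal minors and negative determinant: [B] has no zero
and exactly one negative eigenvalue, hence [k] positive ones. *)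
Lemma PMP_index_bounds k n (A : 'M[C]_n) :
    A \is hermsymmx -> PMP k A -> ~ PMP k.+1 A ->
  (k <= pos_index A)%N /\ (1 <= neg_index A)%N.
Proof.
move=> Ah PA nPA.
have [S /andP[cS minor_nge0]] :
    exists S : {set 'I_n}, (#|S| == k.+1) && ~~ (0 <= principal_minor A S).
  apply/existsP; apply: contraT => /existsPn minors_ge0.
  case: nPA => S /andP[S_gt0]; rewrite leq_eqVlt => /orP[cS|cS].
    by have := minors_ge0 S; rewrite cS negbK.
  by apply: PA; rewrite S_gt0.
pose B := principal_submx A S.
have Bh : B \is hermsymmx by apply: hermsymmx_mxsub.
have detB : ~~ (0 <= \det B) by [].
have zero0 : zero_index B = 0%N.
  apply/eqP; rewrite -leqn0 leqNgt -has_count; apply: contra detB.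
  case/hasP=> x xB /eqP x0; rewrite x0 in xB.
  by rewrite det_eigenvalues (big_rem _ xB) /= mul0r.
have neg_ge1 : (1 <= neg_index B)%N.
  rewrite /neg_index -has_count; apply/negPn; apply: contra detB => /hasPn neg0.
  rewrite det_eigenvalues big_seq; apply: prodr_ge0 => x xB.
  by rewrite real_leNgt ?neg0 ?real0 ?(eigenvalues_real Bh).
have neg_le1 : (neg_index B <= 1)%N.
  rewrite neg_index_opp // pos_index_opp_le1 // => T T_neqT.
  rewrite principal_minor_mxsub; last exact: enum_val_inj.
  apply: (PMP_minor_ge0 PA); rewrite card_imset; last exact: enum_val_inj.
  rewrite -ltnS -(eqP cS) -[X in (_ < X)%N]card_ord -cardsT.
  by rewrite proper_card // properT.
have := index_sum Bh; rewrite zero0 addn0 [in RHS](eqP cS).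
have -> : neg_index B = 1%N by apply/eqP; rewrite eqn_leq neg_le1.
rewrite addn1 => -[pos_k]; split.
  by rewrite -pos_k pos_index_mxsub.
exact: leq_trans neg_ge1 (neg_index_mxsub _ Ah).
Qed.

End Forms.

(** * Matrices with prescribed signature *)

Section Construction.
Variable C : numClosedFieldType.

(** The nodes are distinct, so that any [k] rows are independent. *)
Definition power_mx n k : 'M[C]_(n, k) := (Vandermonde k (\row_(i < n) i%:R))^T.

Lemma rowsub_power_mx_inj j n k (f : 'I_j -> 'I_n) (u : 'rV[C]_j) :
  injective f -> (j <= k)%N -> u *m rowsub f (power_mx n k) = 0 -> u = 0.
Proof.
move=> f_inj le_jk uW.
(* The first [j] columns already form an invertible square matrix. *)
pose a : 'rV[C]_j := \row_i (f i)%:R.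
have Va_unit : (Vandermonde j a)^T \in unitmx.
  rewrite unitmx_tr unitmxE det_Vandermonde unitfE.
  apply/prodf_neq0 => i _; apply/prodf_neq0 => l lt_il.
  rewrite !mxE subr_eq0 eqr_nat; apply: contraTneq lt_il => /val_inj/f_inj->.
  by rewrite ltnn.
apply: (row_free_inj (m := 1) (A := (Vandermonde j a)^T)).
  by rewrite row_free_unit.
rewrite mul0mx; apply/rowP=> l; rewrite [RHS]mxE.
have /rowP/(_ (widen_ord le_jk l)) := uW; rewrite [RHS]mxE => <-.
by rewrite !mxE; apply: eq_bigr => i _; rewrite !mxE.
Qed.

Definition gram n k (W : 'M[C]_(n, k)) : 'M_n := W *m W^t*.

Lemma gram_herm n k (W : 'M[C]_(n, k)) : gram W \is hermsymmx.
Proof. by apply/hermsymmxP; rewrite trmx_mul map_mxM trmxCK. Qed.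

Lemma mxsub_gram m n k (f : 'I_m -> 'I_n) (W : 'M[C]_(n, k)) :
  mxsub f f (gram W) = gram (rowsub f W).
Proof. by rewrite mxsub_mul; congr (_ *m _); apply/matrixP=> i j; rewrite !mxE. Qed.

Lemma qform_gram n k (W : 'M[C]_(n, k)) u : qform (gram W) u = qform 1%:M (u *m W).
Proof. by rewrite -qform_congr mulmx1. Qed.

Definition gram_shift n k (W : 'M[C]_(n, k)) (eps : C) : 'M_n :=
  gram W - eps%:M.

Lemma eigenvalues_gram_shift n k (W : 'M[C]_(n, k)) eps :
  perm_eq (eigenvalues (gram_shift W eps)) [seq x - eps | x <- eigenvalues (gram W)].
Proof.
have := eigenvalues_affine 1 (- eps) (gram_herm W).
by rewrite scale1r raddfN (eq_map (g := fun x => x - eps)) // => x; rewrite mul1r.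
Qed.

Lemma gram_shift_herm n k (W : 'M[C]_(n, k)) eps :
  eps \is Num.real -> gram_shift W eps \is hermsymmx.
Proof.
move=> eps_real; have := @hermsymmx_affine _ _ (gram W) 1 (- eps).
by rewrite scale1r raddfN rpredN real1 => -> //; apply: gram_herm.
Qed.

Lemma mxsub_gram_shift m n k (f : 'I_m -> 'I_n) (W : 'M[C]_(n, k)) eps :
  injective f -> mxsub f f (gram_shift W eps) = gram_shift (rowsub f W) eps.
Proof.
move=> f_inj; rewrite /gram_shift -mxsub_gram.
by apply/matrixP=> i j; rewrite !mxE (inj_eq f_inj).
Qed.

Lemma gram_eigenvalues_gt0 n k (W : 'M[C]_(n, k)) :
  (forall u : 'rV_n, u *m W = 0 -> u = 0) ->
  all (fun x => 0 < x) (eigenvalues (gram W)).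
Proof.
move=> W_inj; have le_pos : (n <= pos_index (gram W))%N.
  apply: (@pos_index_ge _ _ _ _ 1%:M) => [|u u_neq0]; first exact: gram_herm.
  rewrite mulmx1 qform_gram qform1_gt0 //; apply: contra_neq u_neq0; exact: W_inj.
by rewrite all_count eqn_leq count_size size_eigenvalues.
Qed.

Lemma exists_pos_lower_bound (s : seq C) :
  all (fun x => 0 < x) s -> exists2 eps, 0 < eps & all (fun x => eps < x) s.
Proof.
elim: s => [|x s IHs] /=; first by exists 1.
case/andP=> x_gt0 /IHs[e e_gt0 lt_e].
have y_gt0 : 0 < x / 2 by rewrite divr_gt0 ?ltr0n.
have lt_yx : x / 2 < x by rewrite ltr_pdivrMr ?ltr0n // mulr_natr mulr2n ltrDl.
case: (real_leP (gtr0_real y_gt0) (gtr0_real e_gt0)) => [le_ye|lt_ey].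
  exists (x / 2) => //; rewrite lt_yx; apply: sub_all lt_e => z.
  exact: le_lt_trans.
by exists e => //; rewrite (lt_trans lt_ey).
Qed.

(** On the left kernel of [W], of dimension at least [n - k], the shifted form
is [- eps] times the standard one. *)
Lemma signature_gram_shift n k (W : 'M[C]_(n, k)) eps :
    0 < eps -> (k <= n)%N -> (k <= pos_index (gram_shift W eps))%N ->
  signature (gram_shift W eps) = (k, 0, n - k)%N.
Proof.
move=> eps_gt0 le_kn pos_ge.
have Ah := gram_shift_herm W (gtr0_real eps_gt0).
have neg_ge : (n - k <= neg_index (gram_shift W eps))%N.
  rewrite neg_index_opp //.
  apply: leq_trans (leq_sub2l n (rank_leq_col W)) _; rewrite -mxrank_ker.
  apply: (@pos_index_ge _ _ _ _ (row_base (kermx W))) => [|u u_neq0].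
    exact: hermsymmxN.
  have uK0 : u *m row_base (kermx W) *m W = 0.
    by apply/sub_kermxP; rewrite (submx_trans (submxMl _ _)) // eq_row_base.
  rewrite qformN qformD qformN qform_gram (qform_scalar eps) uK0.
  rewrite qform0 add0r opprK mulr_gt0 // qform1_gt0 //.
  apply: contra_neq u_neq0 => u0; apply: (row_free_inj (row_base_free (kermx W))).
  by rewrite u0 mul0mx.
have := index_sum Ah; rewrite /signature.
move: (pos_index _) (zero_index _) (neg_index _) pos_ge neg_ge => p z m.
by move=> le_kp le_nkm p_z_m; congr (_, _, _); lia.
Qed.

Lemma prod_lt0 (s : seq C) : {in s, forall x, x \is Num.real} ->
  count (fun x => x == 0) s = 0%N -> count (fun x => (x < 0)%R) s = 1%N ->
  \prod_(x <- s) x < 0.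
Proof.
move=> s_real zero0 neg1.
have /hasP[x xs x_lt0] : has (fun x => x < 0) s by rewrite has_count neg1.
have s_x := perm_to_rem xs; rewrite (perm_big _ s_x) big_cons /=.
move: zero0 neg1; rewrite !(seq.permP s_x) /= x_lt0 (lt_eqF x_lt0) => zero0 [neg0].
rewrite nmulr_rlt0 // big_seq prodr_gt0 // => y ys.
have := s_real y (mem_rem ys); case/real_ltgt0P => // y_sg.
  by move/eqP: neg0; rewrite -leqn0 leqNgt -has_count => /hasPn/(_ y ys); rewrite y_sg.
by move/eqP: zero0; rewrite -leqn0 leqNgt -has_count => /hasPn/(_ y ys); rewrite y_sg eqxx.
Qed.

(** The Gram matrix of [n] vectors of dimension [k], any [k] of them
independent, is positive definite on every set of at most [k] indices.  This
survives the subtraction of a small scalar [eps], which turns the zero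
eigenvalues negative, both for the whole matrix and for its principal
submatrices of size [k + 1]; the determinant of the latter becomes negative. *)
Lemma exists_minimal_pos_index k n : (k < n)%N ->
  exists A : 'M[C]_n, [/\ A \is hermsymmx, signature A = (k, 0, n - k)%N,
    PMP k A & ~ PMP k.+1 A].
Proof.
move=> lt_kn; pose W := power_mx n k.
pose small := enum [pred S : {set 'I_n} | (#|S| <= k)%N].
have [eps eps_gt0 eps_lt] : exists2 eps : C, 0 < eps &
    all (fun x => eps < x)
      (flatten [seq eigenvalues (principal_submx (gram W) T) | T <- small]).
  apply: exists_pos_lower_bound; apply/allP=> x /flatten_mapP[S].
  rewrite mem_enum inE => cS; apply/allP.
  rewrite /principal_submx mxsub_gram; apply: gram_eigenvalues_gt0 => u.
  exact: rowsub_power_mx_inj enum_val_inj cS.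
pose A := gram_shift W eps.
have Ah : A \is hermsymmx := gram_shift_herm W (gtr0_real eps_gt0).
have sub_gt0 (S : {set 'I_n}) : (#|S| <= k)%N ->
    all (fun x => 0 < x) (eigenvalues (principal_submx A S)).
  move=> cS; rewrite /principal_submx mxsub_gram_shift; last exact: enum_val_inj.
  rewrite (perm_all _ (eigenvalues_gram_shift _ _)) all_map -mxsub_gram.
  apply/allP=> x xS /=; rewrite subr_gt0.
  apply: (allP eps_lt); apply/flatten_mapP; exists S => //.
  by rewrite mem_enum inE.
pose S1 : {set 'I_n} := [set widen_ord lt_kn i | i : 'I_k.+1].
have cS1 : #|S1| = k.+1.
  rewrite card_imset ?card_ord // => i j /(congr1 val) /=; exact: val_inj.
have sig_S (S : {set 'I_n}) : #|S| = k.+1 -> signature (principal_submx A S) = (k, 0, 1)%N.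
  move=> cS; have -> : principal_submx A S =
      gram_shift (rowsub (@enum_val _ (mem S)) W) eps.
    by rewrite /principal_submx mxsub_gram_shift //; apply: enum_val_inj.
  rewrite signature_gram_shift ?cS ?subSnn //.
  have /card_gt0P[x xS] : (0 < #|S|)%N by rewrite cS.
  have cSx : #|S :\ x| = k by apply: succn_inj; rewrite -cS [in RHS](cardsD1 x) xS.
  rewrite -mxsub_gram_shift; last exact: enum_val_inj.
  have [|g gE] := @enum_rank_codom _ _ (@enum_val _ (mem (S :\ x))) S.
    by move=> i; have := enum_valP i; rewrite inE => /andP[].
  have sub_g : principal_submx A (S :\ x) = mxsub g g (principal_submx A S).
    by apply/matrixP=> i j; rewrite !mxE !gE.
  have := sub_gt0 _ (eq_leq cSx); rewrite all_count size_eigenvalues => /eqP.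
  rewrite [in RHS]cSx => pos_Sx; rewrite -[X in (X <= _)%N]pos_Sx.
  by rewrite sub_g; exact/pos_index_mxsub/hermsymmx_mxsub.
have pos_ge : (k <= pos_index A)%N.
  have [<- _ _] := sig_S _ cS1; exact: pos_index_mxsub.
exists A; split => //.
- exact: signature_gram_shift (ltnW lt_kn) pos_ge.
- move=> S /andP[_ cS].
  rewrite [principal_minor _ _]det_eigenvalues big_seq prodr_ge0 // => x xS.
  exact/ltW/(allP (sub_gt0 _ cS)).
move=> /PMP_minor_ge0/(_ (eq_leq cS1)); rewrite [principal_minor _ _]det_eigenvalues => /le_gtF.
have [_ zero0 neg1] := sig_S _ cS1.
rewrite prod_lt0 //; exact/eigenvalues_real/hermsymmx_mxsub.
Qed.

End Construction.
(** * The possible signatures *)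

Local Open Scope complex_scope.

Theorem theorem3p1 (R : realType) (k N : nat) (hkN : (k < N)%N) :
  (forall A : 'M[R[i]]_N,
      A \is hermsymmx -> PMP k A -> ~ PMP k.+1 A ->
      (k <= pos_index A)%N /\ (1 <= neg_index A)%N) /\
  (forall np n0 nm : nat,
      (k <= np)%N -> (np + n0 + nm = N)%N -> (1 <= nm)%N ->
      exists A : 'M[R[i]]_N,
        [/\ A \is hermsymmx, signature A = (np, n0, nm),
            PMP k A & ~ PMP k.+1 A]).
Proof.
split=> [A|np n0 nm le_k_np sum_N nm_gt0]; first exact: PMP_index_bounds.
have sum_N' : N = (k + nm + (np - k + n0))%N by lia.
clear hkN sum_N; subst N.
have lt_k : (k < k + nm)%N by rewrite -addn1 leq_add2l.
have [A [Ah sigA PA nPA]] := exists_minimal_pos_index (complex R) lt_k.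
(* The remaining positive and zero eigenvalues go into nonnegative scalar blocks:
   a direct sum with such a block multiplies minors by nonnegative factors. *)
pose D : 'M[R[i]]_(np - k + n0) := block_mx 1%:M 0 0 0%:M.
exists (block_mx A 0 0 D); split.
- by rewrite !hermsymmx_block ?hermsymmx_scalar ?real1 ?real0.
- have sigD := signature_block (signature_scalar (np - k) (1 : R[i]))
    (signature_scalar n0 (0 : R[i])).
  rewrite (signature_block sigA sigD) ltr01 eqxx ltxx oner_eq0 ltr10.
  by rewrite !mul0n !mul1n !addn0 add0n addKn subnKC.
- by apply: PMP_block => //; apply: PMP_block; apply: PMP_scalar.
move=> PAD; apply: nPA; have := PMP_mxsub (@lshift_inj _ _) PAD.
suff -> : mxsub (lshift _) (lshift _) (block_mx A 0 0 D) = A by [].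
by apply/matrixP=> i j; rewrite mxE block_mxEul.
Qed.
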